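(* Let $r,n\ge 1$ be integers, let $s\in\{1,\dots,r\}$ and let $k\in\{0,1,\dots,n\}$. Let $\mathcal{B}$ be the family of all words $w\in[s]^n$ in which the symbol $s$ appears at most $k$ times. Then for every family $\mathcal{F}\subseteq[r]^n$ with $|\mathcal{F}|=|\mathcal{B}|$ we have $|\Delta\mathcal{F}|\ge|\Delta\mathcal{B}|$. That is, $\mathcal{B}$ has minimal deletion shadow among all families in $[r]^n$ of the same size.
   Context: Words of length $n$ over the alphabet $[r]=\{1,\dots,r\}$ are elements of $[r]^n$. For a family $\mathcal{F}\subseteq[r]^n$ and $i\in[n]$, the deletion shadow in direction $i$ is $\delta_i\mathcal{F}=\{(x_1,\dots,x_{i-1},x_{i+1},\dots,x_n):(x_1,\dots,x_n)\in\mathcal{F}\}\subseteq[r]^{n-1}$, and the deletion shadow is $\Delta\mathcal{F}=\bigcup_{i=1}^n\delta_i\mathcal{F}$, i.e. the set of all words obtainable by deleting one letter from a word of $\mathcal{F}$. *)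

(* Defs.v *)
From mathcomp Require Import all_boot.
Set Implicit Arguments. Unset Strict Implicit. Unset Printing Implicit Defensive.

(* Words of length n over [r] = {1..r} are encoded as n.-tuple 'I_r,
   letter j+1 being represented by the ordinal j. *)

Definition del_seq (T : Type) (i : nat) (s : seq T) : seq T :=
  take i s ++ drop i.+1 s.

Lemma size_del_tuple (T : Type) (n : nat) (t : n.-tuple T) (i : 'I_n) :
  size (del_seq i t) == n.-1.
Proof.
rewrite /del_seq size_cat size_take size_drop size_tuple.
case: i => i /= lt_in; rewrite lt_in; apply/eqP.
by case: n t lt_in => // n _ lt; rewrite /= subSS addnC subnK //.
Qed.

Definition del_tuple (T : Type) (n : nat) (t : n.-tuple T) (i : 'I_n) :
  n.-1.-tuple T := Tuple (size_del_tuple t i).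

Definition delta_i (r n : nat) (F : {set n.-tuple 'I_r}) (i : 'I_n)
  : {set n.-1.-tuple 'I_r} := [set del_tuple w i | w in F].

Definition shadow (r n : nat) (F : {set n.-tuple 'I_r})
  : {set n.-1.-tuple 'I_r} := \bigcup_(i : 'I_n) delta_i F i.

(* The family B: words in [s]^n (all letters <= s, i.e. ordinal value < s)
   in which the symbol s (ordinal value s-1) appears at most k times. *)
Definition famB (r n s k : nat) : {set n.-tuple 'I_r} :=
  [set w : n.-tuple 'I_r |
     all (fun a : 'I_r => a < s) w && (count (fun a : 'I_r => a == s.-1 :> nat) w <= k)].

(* Main.v *)
(* Let t = s - 1, and let b(n, k) be the number of words in [s]^n with fewer than k
   letters s. For words of length n + 1 let g be the piecewise linear function
   through the points (b(n + 1, k), b(n, k)); its slopes (n + 1 - k) / ((n + 1) t)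
   decrease to 0, so g is concave, and it is the minimum of the lines carrying its
   pieces. The bound |Delta F| >= g(|F|) follows by induction on n: the sections F_a
   of F by the first letter satisfy |F_a| <= |Delta F| and
   sum_a |Delta F_a| <= |Delta F|. If |Delta F| < y := g(|F|), then every |F_a| is
   below y, and by concavity the sum of the g(|F_a|) is least when the mass |F| is
   packed into t sections of size y and one of size |F| - t y. The recurrence
   b(n + 1, k + 1) = t b(n, k + 1) + b(n, k) shows that this least value is y. *)

Require Import Defs.
From mathcomp Require Import all_boot.
From mathcomp Require Import all_order all_algebra.
From mathcomp Require Import zify lra.
Import Order.TTheory GRing.Theory Num.Theory.

Set Implicit Arguments.
Unset Strict Implicit.
Unset Printing Implicit Defensive.

(** * Sections by the first letter, and shadows *)

Definition tail_section (r n : nat) (F : {set n.+1.-tuple 'I_r}) (a : 'I_r) :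
  {set n.-tuple 'I_r} := [set w : n.-tuple 'I_r | cons_tuple a w \in F].

Lemma card_tail_section (r n : nat) (F : {set n.+1.-tuple 'I_r}) :
  #|F| = \sum_(a : 'I_r) #|tail_section F a|.
Proof.
rewrite -sum1_card (partition_big (fun w : n.+1.-tuple 'I_r => thead w) xpredT) //=.
apply: eq_bigr => a _; rewrite sum1dep_card.
have inj_cons : injective (fun w : n.-tuple 'I_r => cons_tuple a w).
  by move=> u v /(congr1 val) /= [] /val_inj.
rewrite -(card_imset _ inj_cons); apply: eq_card => w; rewrite inE.
apply/idP/imsetP => [/andP[Fw /eqP aw]|[u]].
  exists (behead_tuple w); last by rewrite {1}(tuple_eta w) aw; apply: val_inj.
  rewrite inE; suff -> : cons_tuple a (behead_tuple w) = w by [].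
  by rewrite [RHS]tuple_eta aw; apply: val_inj.
by rewrite inE => Fu ->; rewrite Fu theadE /=.
Qed.

Lemma shadowP (r n : nat) (F : {set n.-tuple 'I_r}) (w : n.-1.-tuple 'I_r) :
  reflect (exists2 u, u \in F & exists i, w = del_tuple u i) (w \in shadow F).
Proof.
apply: (iffP bigcupP) => [[i _ /imsetP[u Fu ->]]|[u Fu [i ->]]].
  by exists u => //; exists i.
by exists i => //; apply: imset_f.
Qed.

Lemma tail_section_sub_shadow (r n : nat) (F : {set n.+1.-tuple 'I_r}) (a : 'I_r) :
  tail_section F a \subset shadow F.
Proof.
apply/subsetP => w; rewrite inE => Fw; apply/shadowP.
exists (cons_tuple a w) => //; exists ord0.
by apply: val_inj; rewrite /= /del_seq /= drop0.
Qed.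

Lemma shadow_tail_section (r n : nat) (F : {set n.+2.-tuple 'I_r}) (a : 'I_r) :
  shadow (tail_section F a) \subset tail_section (shadow F) a.
Proof.
apply/subsetP => w /shadowP[u]; rewrite !inE => Fu [i ->].
apply/(@shadowP _ n.+2); exists (cons_tuple a u) => //; exists (lift ord0 i).
exact: val_inj.
Qed.

Lemma shadow_eq0 (r n : nat) (F : {set n.+1.-tuple 'I_r}) :
  (shadow F == set0) = (F == set0).
Proof.
apply/eqP/eqP => [sF0|->].
  apply/setP => w; rewrite !inE; apply/negP => Fw.
  suff: del_tuple w ord0 \in shadow F by rewrite sF0 inE.
  by apply/shadowP; exists w => //; exists ord0.
by apply/setP => w; rewrite inE; apply/shadowP => -[u]; rewrite inE.
Qed.

(** Deletion leaves a subsequence, so no letter count grows; this bounds the shadow above by a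
    family of known size. *)
Lemma shadow_famB (r n s k : nat) : shadow (famB r n s k) \subset famB r n.-1 s k.
Proof.
apply/subsetP => w /shadowP[u]; rewrite !inE => /andP[/allP sB ck] [i ->] /=.
have sub : subseq (del_seq i u) u.
  by rewrite -[X in subseq _ X](cat_take_drop i) cat_subseq // -addn1 addnC -drop_drop drop_subseq.
apply/andP; split; first by apply/allP => a /(mem_subseq sub) /sB.
by rewrite (leq_trans _ ck) // leq_count_subseq.
Qed.

(** * Counting words by occurrences of one letter *)

(* The number of words of length n over t + 1 letters having exactly k
   occurrences of one given letter. *)
Definition layer (t n k : nat) := 'C(n, k) * t ^ (n - k).

(** The strict bound makes [ball t n 0] vanish, so the first chord starts at the origin. *)
Definition ball (t n k : nat) := \sum_(j < k) layer t n j.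

Lemma ballS (t n k : nat) : ball t n k.+1 = ball t n k + layer t n k.
Proof. by rewrite /ball big_ord_recr. Qed.

Lemma ball0 (t n : nat) : ball t n 0 = 0.
Proof. by rewrite /ball big_ord0. Qed.

Lemma layer_rec0 (t n : nat) : layer t n.+1 0 = t * layer t n 0.
Proof. by rewrite /layer !bin0 !subn0 !mul1n expnS. Qed.

Lemma layer_rec (t n k : nat) : layer t n.+1 k.+1 = t * layer t n k.+1 + layer t n k.
Proof.
rewrite /layer binS mulnDl subSS; congr (_ + _); have [lt_kn|le_nk] := ltnP k n.
  by rewrite mulnCA -expnS subnSK.
by rewrite bin_small // !mul0n muln0.
Qed.

Lemma ball_rec (t n k : nat) : ball t n.+1 k.+1 = t * ball t n k.+1 + ball t n k.
Proof.
elim: k => [|k IHk]; first by rewrite !ballS !ball0 layer_rec0 addn0.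
rewrite ballS IHk layer_rec (ballS t n k.+1) mulnDr [X in _ = _ + X]ballS.
by rewrite addnACA.
Qed.

Lemma ball_len0 (t k : nat) : ball t 0 k.+1 = 1.
Proof.
elim: k => [|k IHk]; first by rewrite ballS ball0.
by rewrite ballS IHk.
Qed.

(** For [t = 0] the slopes divide by 0, so a one-letter alphabet is treated apart. *)
Lemma ball_t0 (n k : nat) : ball 0 n k <= 1.
Proof.
elim: n k => [|n IHn] [|k]; rewrite ?ball0 ?ball_len0 //.
by rewrite ball_rec mul0n add0n.
Qed.

Lemma card_famB (r n t k : nat) : t < r -> #|famB r n t.+1 k| = ball t n k.+1.
Proof.
move=> lt_tr; elim: n k => [|n IHn] k.
  have -> : famB r 0 t.+1 k = setT by apply/setP => w; rewrite !inE tuple0.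
  by rewrite ball_len0 cardsT card_tuple expn0.
rewrite card_tail_section ball_rec (bigID (fun a : 'I_r => a < t)) /=.
congr (_ + _).
  rewrite (eq_bigr (fun=> ball t n k.+1)) => [|a lt_at]; last first.
    rewrite -IHn; apply: eq_card => w.
    by rewrite !inE /= (ltn_eqF lt_at) add0n ltnS (ltnW lt_at).
  rewrite -(@big_ord_widen _ _ _ t r (fun=> ball t n k.+1)) 1?ltnW //.
  by rewrite sum_nat_const card_ord.
rewrite (bigD1 (Ordinal lt_tr)) ?ltnn //= [X in _ + X]big1 => [|a /andP[ge_at neq_at]].
  rewrite addn0; case: k => [|k].
    rewrite ball0; apply/eqP; rewrite cards_eq0; apply/eqP/setP => w.
    by rewrite !inE /= eqxx andbF.
  by rewrite -IHn; apply: eq_card => w; rewrite !inE /= eqxx ltnSn add1n ltnS.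
apply/eqP; rewrite cards_eq0; apply/eqP/setP => w; rewrite !inE /=.
rewrite ltnS leqNgt ltn_neqAle leqNgt ge_at andbT eq_sym.
by rewrite -(inj_eq val_inj) /= in neq_at; rewrite neq_at.
Qed.

(** * The concave bound and its chords *)

Section ChordBound.

Local Open Scope ring_scope.

(** Since [d] is the largest point, the sum does not grow when [a], [b] move apart to [c], [d] and
    the line of smaller slope takes [d]. *)
Lemma affine_exchange (R : realFieldType) (p1 q1 p2 q2 a b c d : R) :
  a + b = c + d -> c <= a -> c <= b -> 
  (p1 * c + q1) + (p2 * d + q2) <= (p1 * a + q1) + (p2 * b + q2) \/
  (p2 * c + q2) + (p1 * d + q1) <= (p1 * a + q1) + (p2 * b + q2).
Proof.
move=> eq_s le_ca le_cb; have [le_p|lt_p] := lerP p2 p1; [left|right].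
  have := mulr_ge0 (x := p1 - p2) (y := a - c); rewrite !subr_ge0 => /(_ le_p le_ca).
  have -> : d = a + b - c by lra.
  nra.
have := mulr_ge0 (x := p2 - p1) (y := b - c); rewrite !subr_ge0 => /(_ (ltW lt_p) le_cb).
have -> : d = a + b - c by lra.
nra.
Qed.

(* The lower envelope of the lines is a concave function vanishing at 0, so
   merging two values, and splitting off a full y whenever the merged value
   reaches y, only decreases the sum. *)
Lemma packing (R : realFieldType) (I J : Type) (p q : I -> R) (i0 : I) (y G : R)
    (s : seq J) (x d : J -> R) :
  (forall i, 0 <= q i) -> q i0 = 0 -> 0 < y ->
  (forall i, G <= p i * y + q i) ->
  (forall j, 0 <= x j < y) -> (forall j, exists i, p i * x j + q i <= d j) ->
  exists m rem i,
    [/\ \sum_(j <- s) x j = m%:R * y + rem, 0 <= rem < y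
      & m%:R * G + (p i * rem + q i) <= \sum_(j <- s) d j].
Proof.
move=> q_ge0 q0 y_gt0 leG x_y dL; elim: s => [|j s [m [rem [i [sx /andP[r0 ry] sd]]]]].
  by exists 0%N, 0, i0; rewrite !big_nil q0 !mul0r mulr0 !addr0; split; rewrite ?lexx.
have /andP[x0 xy] := x_y j; have [i' dj] := dL j; rewrite !big_cons sx.
have qi_ge0 := q_ge0 i; have qi'_ge0 := q_ge0 i'.
have [lt_y|ge_y] := ltrP (x j + rem) y.
  have := @affine_exchange _ (p i') (q i') (p i) (q i) (x j) rem 0 (x j + rem).
  rewrite add0r !mulr0 !add0r => /(_ erefl x0 r0) [] le;
    [exists m, (x j + rem), i|exists m, (x j + rem), i']; split; lra.
(* One line lands on [y], where its value is at least [G], so [m] grows by one. *)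
have := @affine_exchange _ (p i') (q i') (p i) (q i) (x j) rem (x j + rem - y) y.
have leGi := leG i; have leGi' := leG i'.
case=> [|||le|le]; first lra; first lra; first lra;
  [exists m.+1, (x j + rem - y), i'|exists m.+1, (x j + rem - y), i];
  rewrite -natr1; split; lra.
Qed.

(* The ratio of layer t n k to layer t n.+1 k; the truncated subtraction makes it 0 for k > n. *)
Definition slope (t n k : nat) : rat := (n.+1 - k)%N%:R / (n.+1 * t)%N%:R.

(* The line through (ball t n.+1 j, ball t n j) for j = k and j = k.+1. *)
Definition chord (t n k : nat) (x : rat) : rat :=
  (ball t n k)%:R + slope t n k * (x - (ball t n.+1 k)%:R).

Lemma slope_ge0 (t n k : nat) : 0 <= slope t n k.
Proof. by rewrite divr_ge0 ?ler0n. Qed.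

Lemma le_slope (t n j k : nat) : (j <= k)%N -> slope t n k <= slope t n j.
Proof.
by move=> le_jk; rewrite ler_wpM2r ?invr_ge0 ?ler0n // ler_nat leq_sub2l.
Qed.

Lemma layer_slope (t n k : nat) : (0 < t)%N ->
  (layer t n k)%:R = slope t n k * (layer t n.+1 k)%:R.
Proof.
move=> t_gt0; rewrite /slope mulrAC.
apply: (canRL (mulfK _)); first by rewrite pnatr_eq0 -lt0n muln_gt0.
rewrite -!natrM; congr (_%:R); rewrite /layer.
have [le_kn|lt_nk] := leqP k n; last first.
  by rewrite bin_small // (eqP (_ : n.+1 - k == 0)%N) ?subn_eq0.
rewrite [RHS]mulnA -mul_bin_down /= subSn // expnS.
by rewrite mulnACA [(_ * n.+1)%N]mulnC [(_ * t)%N]mulnC.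
Qed.

(** Slopes decrease: right of [k] each layer adds at most what the chord does, left of [k] at
    least. *)
Lemma ball_le_chord (t n k j : nat) : (0 < t)%N ->
  (ball t n j)%:R <= chord t n k (ball t n.+1 j)%:R.
Proof.
move=> t_gt0; have layer_ge0 i : 0 <= (layer t n.+1 i)%:R :> rat by rewrite ler0n.
have [le_kj|/ltnW le_jk] := leqP k j.
  rewrite -(subnKC le_kj); elim: (j - k)%N => [|m IHm].
    by rewrite addn0 /chord subrr mulr0 addr0.
  have := ler_wpM2r (layer_ge0 (k + m)%N) (le_slope t n (leq_addr m k)).
  move: IHm; rewrite addnS !ballS !natrD (layer_slope n) // /chord; lra.
have [m ->] : exists m, k = (m + j)%N by exists (k - j)%N; rewrite subnK.
elim: m {le_jk} j => [|m IHm] j.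
  by rewrite add0n /chord subrr mulr0 addr0.
have := ler_wpM2r (layer_ge0 j) (le_slope t n (leq_addl m.+1 j)).
have := IHm j.+1; rewrite -addSnnS !ballS !natrD (layer_slope n) // /chord; lra.
Qed.

Lemma interpolation_le_chord (t n i k : nat) (lam : rat) : (0 < t)%N -> 0 <= lam <= 1 ->
  (ball t n k)%:R + lam * (layer t n k)%:R <=
  chord t n i ((ball t n.+1 k)%:R + lam * (layer t n.+1 k)%:R).
Proof.
move=> t_gt0 /andP[lam_ge0 lam_le1].
have := ler_wpM2l lam_ge0 (ball_le_chord n i k.+1 t_gt0).
have lam'_ge0 : 0 <= 1 - lam by rewrite subr_ge0.
have := ler_wpM2l lam'_ge0 (ball_le_chord n i k t_gt0).
rewrite !ballS !natrD /chord; lra.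
Qed.

Lemma exists_supporting_chord (t n X : nat) : (0 < t)%N -> exists k lam,
  [/\ 0 <= lam <= 1,
      (ball t n.+1 k)%:R + lam * (layer t n.+1 k)%:R <= X%:R &
      chord t n k X%:R = (ball t n k)%:R + lam * (layer t n k)%:R].
Proof.
move=> t_gt0; have [lt_X|le_X] := ltnP X (ball t n.+1 n.+2).
  have /ex_minnP[[|k]] : exists k, (X < ball t n.+1 k)%N by exists n.+2.
    by rewrite ball0.
  move=> lt_Xk min_k; have le_kX : (ball t n.+1 k <= X)%N.
    by rewrite leqNgt; apply/negP => /min_k; rewrite ltnn.
  have layer_gt0 : 0 < (layer t n.+1 k)%:R :> rat.
    by rewrite ltr0n; move: lt_Xk; rewrite ballS; lia.
  exists k, ((X%:R - (ball t n.+1 k)%:R) / (layer t n.+1 k)%:R).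
  rewrite divfK ?gt_eqF // subrKC lexx (layer_slope n) //.
  rewrite mulrCA divfK ?gt_eqF //.
  rewrite divr_ge0 ?subr_ge0 ?ler_nat ?ler0n // ler_pdivrMr // mul1r lerBlDr.
  by rewrite addrC -natrD -ballS ler_nat ltnW.
(* Beyond the last breakpoint chord [n.+1] is horizontal, hence only an inequality for [X]. *)
exists n.+1, 1; rewrite ler01 lexx !mul1r -!natrD -!ballS ler_nat le_X.
by rewrite /chord /slope subnn !mul0r addr0 [in RHS]ballS /layer bin_small // mul0n addn0.
Qed.

(** The induction step in numbers: [x] stands for the section sizes, [d] for their shadow sizes, [D]
    for the whole shadow. *)
Lemma chord_sum (t n : nat) (J : Type) (s : seq J) (x d : J -> nat) (D : nat) :
  (0 < t)%N -> (forall j, (x j <= D)%N) -> (\sum_(j <- s) d j <= D)%N ->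
  (forall j, exists k, chord t n k (x j)%:R <= (d j)%:R) ->
  exists k, chord t n.+1 k (\sum_(j <- s) x j)%N%:R <= D%:R.
Proof.
move=> t_gt0 le_xD le_dD dL; set X := (\sum_(j <- s) x j)%N.
have [k [lam [lam01 le_X chordE]]] := exists_supporting_chord n.+1 X t_gt0.
have [le_yD|lt_Dy] := lerP ((ball t n.+1 k)%:R + lam * (layer t n.+1 k)%:R) D%:R.
  by exists k; rewrite chordE.
(* Now x j < y for all j, so the sum of the envelope over the x j is smallest
   for t values equal to y and one equal to z, where it is y. *)
exfalso; set y := _ + _ in lt_Dy.
have leG i := interpolation_le_chord n i k t_gt0 lam01; rewrite -/y in leG.
set G := _ + _ in leG.
(* [z] and [H] are [y] and [G] with [k] lowered by one and the same [lam] (both 0 if [k = 0]); the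
   equations are the recurrence. *)
have [z [H [z_ge0 le_HG leH eq_z eq_y]]] : exists z H, [/\ 0 <= z, H <= G,
    forall i, H <= chord t n i z,
    t%:R * y + z = (ball t n.+2 k)%:R + lam * (layer t n.+2 k)%:R &
    y = t%:R * G + H].
  have lam_ge0 : 0 <= lam by case/andP: lam01.
  have G_ge0 : 0 <= G by rewrite addr_ge0 ?mulr_ge0 ?ler0n.
  move: G_ge0; rewrite /y /G; case: (k) => [|k'] G_ge0.
    exists 0, 0; split=> // [i||].
    - by have := ball_le_chord n i 0 t_gt0; rewrite !ball0.
    - rewrite !ball0 (layer_rec0 t n.+1) natrM; lra.
    - rewrite !ball0 (layer_rec0 t n) natrM; lra.
  exists ((ball t n.+1 k')%:R + lam * (layer t n.+1 k')%:R),
    ((ball t n k')%:R + lam * (layer t n k')%:R).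
  split=> [||i||].
  - by rewrite addr_ge0 ?mulr_ge0 ?ler0n.
  - rewrite ballS natrD.
    have : 0 <= (1 - lam) * (layer t n k')%:R + lam * (layer t n k'.+1)%:R.
      by case/andP: lam01 => _ le1; rewrite addr_ge0 ?mulr_ge0 ?subr_ge0 ?ler0n.
    lra.
  - exact: interpolation_le_chord.
  - rewrite (ball_rec t n.+1) (layer_rec t n.+1) !natrD !natrM; lra.
  - rewrite (ball_rec t n) (layer_rec t n) !natrD !natrM; lra.
have chord_affine i u : chord t n i u =
    slope t n i * u + ((ball t n i)%:R - slope t n i * (ball t n.+1 i)%:R).
  by rewrite /chord mulrBr addrCA.
have [|||i|j|j|m [rem [i [eq_X /andP[rem_ge0 rem_lt] le_d]]]] :=
    @packing _ _ _ (slope t n)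
      (fun i => (ball t n i)%:R - slope t n i * (ball t n.+1 i)%:R) 0%N y G s
      (fun j => (x j)%:R) (fun j => (d j)%:R).
- move=> i; have := ball_le_chord n i 0 t_gt0.
  by rewrite chord_affine !ball0 mulr0 add0r.
- by rewrite !ball0 mulr0 subr0.
- exact: le_lt_trans lt_Dy.
- by rewrite -chord_affine.
- by rewrite ler0n (le_lt_trans _ lt_Dy) // ler_nat.
- by have [i le_i] := dL j; exists i; rewrite -chord_affine.
move: eq_X le_d; rewrite -!natr_sum -/X -chord_affine => eq_X le_d.
have y_gt0 : 0 < y by exact: le_lt_trans lt_Dy.
(* Otherwise [X = m y + rem < t y], against [t y + z <= X]. *)
have le_tm : (t <= m)%N.
  rewrite leqNgt; apply/negP; rewrite -ltnS -(ler_nat rat) -natr1 => lt_mt.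
  have := ler_wpM2r (ltW y_gt0) lt_mt; lra.
have G_ge0 : 0 <= G by rewrite addr_ge0 ?mulr_ge0 ?ler0n //; case/andP: lam01.
have le_dD' : (\sum_(j <- s) d j)%N%:R <= D%:R :> rat by rewrite ler_nat.
have chord_ge0 : 0 <= chord t n i rem.
  have := ler_wpM2l (slope_ge0 t n i) rem_ge0; rewrite mulr0 chord_affine.
  have := ball_le_chord n i 0 t_gt0; rewrite chord_affine !ball0; lra.
(* If [m = t], then [rem >= z] and the last chord is at least [H]; if [m > t], an extra [G >= H]
   replaces it. Either way the sum reaches [t G + H = y > D]. *)
move: le_tm; rewrite leq_eqVlt => /predU1P[def_m|lt_tm].
  have le_zr : z <= rem by move: eq_X; rewrite -def_m; lra.
  have := ler_wpM2l (slope_ge0 t n i) le_zr.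
  by move: le_d (leH i); rewrite !chord_affine -def_m; lra.
have := ler_wpM2r G_ge0 (_ : t.+1%:R <= m%:R); rewrite ler_nat -natr1 => /(_ lt_tm).
lra.
Qed.

Lemma chord_le_shadow (t r n : nat) (F : {set n.+1.-tuple 'I_r}) : (0 < t)%N ->
  exists k, chord t n k #|F|%:R <= #|shadow F|%:R.
Proof.
move=> t_gt0; elim: n F => [|n IHn] F.
  have [->|F_neq0] := eqVneq F set0.
    by exists 0%N; rewrite cards0 /chord !ball0 subrr mulr0 addr0 ler0n.
  (* For words of length 1, chord 1 is the constant 1. *)
  exists 1%N; rewrite /chord /slope subnn !mul0r addr0 ball_len0 ler_nat.
  by rewrite card_gt0 shadow_eq0.
rewrite card_tail_section.
apply: (chord_sum (d := fun a => #|shadow (tail_section F a)|)) => // [a|].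
- exact/subset_leq_card/tail_section_sub_shadow.
- rewrite (card_tail_section (shadow F : {set n.+1.-tuple 'I_r})).
  by apply: leq_sum => a _; apply/subset_leq_card/shadow_tail_section.
Qed.

End ChordBound.

Theorem theorem2 (r n s k : nat) :
  1 <= r -> 1 <= n -> 1 <= s <= r -> k <= n ->
  forall F : {set n.-tuple 'I_r},
    #|F| = #|famB r n s k| ->
    #|shadow (famB r n s k)| <= #|shadow F|.
Proof.
case: n => // n _ _; case: s => [//|t] /andP[_ lt_tr] _ F cardF.
(* The family is empty when [t = 0] and [k <= n]; the upper bound [ball 0 n k.+1] may then still be
   1. *)
have [famB0|famB_neq0] := eqVneq (famB r n.+1 t.+1 k) set0.
  suff -> : shadow (famB r n.+1 t.+1 k) = set0 by rewrite cards0.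
  by apply/eqP; rewrite shadow_eq0 famB0.
have le_B := subset_leq_card (@shadow_famB r n.+1 t.+1 k).
rewrite card_famB // in le_B; apply: leq_trans (le_B) _.
have [t0|t_gt0] := posnP t.
  rewrite t0 (leq_trans (ball_t0 n k.+1)) // card_gt0 shadow_eq0.
  by rewrite -card_gt0 cardF card_gt0.
(* The size of [F] is a breakpoint, where every chord is at least [ball t n k.+1]. *)
have [i] := chord_le_shadow F t_gt0; rewrite cardF card_famB //.
by move/(le_trans (ball_le_chord n i k.+1 t_gt0)); rewrite ler_nat.
Qed.
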